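(* Let $1<p<\infty$ and let $\nu:\mathbb{R}^d\setminus\{0\}\to[0,\infty)$ be measurable and radial. Then $\int_{\mathbb{R}^d}(1\wedge|h|^p)\nu(h)\,dh<\infty$ if and only if $W^p_\nu(\mathbb{R}^d)\neq\{0\}$.
   Context: $a\wedge b=\min(a,b)$. $W^p_\nu(\mathbb{R}^d)=\{u\in L^p(\mathbb{R}^d):\int_{\mathbb{R}^d}\int_{\mathbb{R}^d}|u(x)-u(y)|^p\nu(x-y)\,dy\,dx<\infty\}$. *)

(* Defs.v *)
From HB Require Import structures.
From mathcomp Require Import all_boot all_order all_algebra.
From mathcomp Require Import all_classical all_reals all_analysis.
From mathcomp Require Import measurable_realfun.

Set Implicit Arguments.
Unset Strict Implicit.
Unset Printing Implicit Defensive.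
Import Order.TTheory GRing.Theory Num.Theory.
Import numFieldNormedType.Exports.

Local Open Scope classical_set_scope.
Local Open Scope ring_scope.

Section borel_lebesgue.
Context {R : realType}.
Local Notation RT := (measurableTypeR R).

Definition cons_pair n (x : RT * n.-tuple RT) : n.+1.-tuple RT :=
  [tuple of x.1 :: x.2].

Lemma measurable_cons_pair n : measurable_fun setT (@cons_pair n).
Proof. exact: measurable_cons. Qed.

Section step.
Variables (n : nat) (m : {sigma_finite_measure set (n.-tuple RT) -> \bar R}).

Definition cons_measure : set (n.+1.-tuple RT) -> \bar R :=
  pushforward (@lebesgue_measure R \x m)%E (@cons_pair n).

Let cons_measure0 : cons_measure set0 = 0%E.
Proof. by rewrite /cons_measure /pushforward preimage_set0 measure0. Qed.

Let cons_measure_ge0 A : (0 <= cons_measure A)%E.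
Proof. by rewrite /cons_measure /pushforward; exact: measure_ge0. Qed.

Let cons_measure_sigma_additive : semi_sigma_additive cons_measure.
Proof.
move=> F mF tF mUF; rewrite /cons_measure /pushforward preimage_bigcup.
apply: measure_semi_sigma_additive.
- by move=> k; rewrite -[X in measurable X]setTI; exact: measurable_cons_pair.
- apply/trivIsetP => /= i j _ _ ij; rewrite -preimage_setI.
  by move/trivIsetP : tF => /(_ _ _ _ _ ij) ->//; rewrite preimage_set0.
- rewrite -preimage_bigcup -[X in measurable X]setTI.
  exact: measurable_cons_pair.
Qed.

HB.instance Definition _ := isMeasure.Build _ _ _ cons_measure
  cons_measure0 cons_measure_ge0 cons_measure_sigma_additive.

Let uncons (t : n.+1.-tuple RT) : RT * n.-tuple RT :=
  (thead t, [tuple of behead t]).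

Let uncons_cons x : uncons (cons_pair x) = x.
Proof.
case: x => a t; rewrite /uncons /cons_pair /= theadE; congr pair.
exact: val_inj.
Qed.

Let measurable_uncons : measurable_fun setT uncons.
Proof.
apply: measurable_fun_pair.
  exact: (@measurable_tnth _ RT n.+1 ord0).
exact: measurable_behead.
Qed.

Let cons_measure_sigma_finite : sigma_finite setT cons_measure.
Proof.
have /sigma_finiteP[F [FT ndF Foo]] := sigma_finiteT (@lebesgue_measure R).
have /sigma_finiteP[G [GT ndG Goo]] := sigma_finiteT m.
exists (fun k => uncons @^-1` (F k `*` G k)).
  rewrite -preimage_bigcup -[LHS](preimage_setT uncons); congr preimage.
  rewrite -setXTT FT GT; apply/seteqP; split=> [[x y]|[x y] [k _ []]].
    move=> [/= [k _ Fkx] [l _ Gly]]; exists (maxn k l) => //; split.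
    - by move: x Fkx; exact/subsetPset/ndF/leq_maxl.
    - by move: y Gly; exact/subsetPset/ndG/leq_maxr.
  by split; exists k.
move=> k; have [mF Fk] := Foo k; have [mG Gk] := Goo k; split.
  rewrite -[X in measurable X]setTI.
  by apply: measurable_uncons => //; exact: measurableX.
rewrite /cons_measure /pushforward.
rewrite (_ : _ @^-1` _ = F k `*` G k); last first.
  by apply/funext => x; exact: (congr1 (F k `*` G k) (uncons_cons x)).
by rewrite product_measure1E// lte_mul_pinfty// ge0_fin_numE.
Qed.

HB.instance Definition _ := Measure_isSigmaFinite.Build _ _ _ cons_measure
  cons_measure_sigma_finite.

End step.

(* the d-fold product of the one-dimensional Lebesgue measure, on the product
   (i.e. Borel) sigma-algebra of R^d *)
Fixpoint borel_lebesgue (d : nat) :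
    {sigma_finite_measure set (d.-tuple RT) -> \bar R} :=
  match d with
  | 0 => (\d_([tuple] : 0.-tuple RT) :
           {sigma_finite_measure set (0.-tuple RT) -> \bar R})
  | n.+1 => cons_measure (borel_lebesgue n)
  end.

End borel_lebesgue.

(* [Rd R d] is R^d with the sigma-algebra of Lebesgue-measurable sets (the
   Caratheodory sigma-algebra of the outer measure generated by
   [borel_lebesgue d]), on which [lebesgue_Rd R d] is the complete
   d-dimensional Lebesgue measure *)
Definition Rd (R : realType) (d : nat) :=
  caratheodory_type ((@borel_lebesgue R d)^*)%mu.
HB.instance Definition _ R d := Measurable.on (Rd R d).

Definition lebesgue_Rd (R : realType) (d : nat) : set (Rd R d) -> \bar R :=
  @completed_measure_extension _ _ _ (@borel_lebesgue R d).
Arguments lebesgue_Rd : clear implicits.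
HB.instance Definition _ R d := Measure.on (lebesgue_Rd R d).

Section euclidean.
Context {R : realType} {d : nat}.
Implicit Types x y : Rd R d.

Definition Rd_zero : Rd R d := [tuple 0 | i < d].

Definition Rd_sub x y : Rd R d :=
  [tuple tnth (x : d.-tuple R) i - tnth (y : d.-tuple R) i | i < d].

Definition enorm x : R := Num.sqrt (\sum_(i < d) tnth (x : d.-tuple R) i ^+ 2).

(* A function on R^d \ {0} is represented by a function on R^d whose value at 0
   is unconstrained. That value never matters below: [nu h] is multiplied by
   min(1, |h|^p) and [nu (x - y)] by |u x - u y|^p, both of which are 0 when the
   argument of [nu] is 0. *)
Definition radial (nu : Rd R d -> R) :=
  forall x y, x <> Rd_zero -> y <> Rd_zero -> enorm x = enorm y -> nu x = nu y.

End euclidean.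

Section Lspace_zero.
Context d (T : measurableType d) (R : realType).
Variables (mu : {measure set T -> \bar R}) (p : R) (p1 : (1 <= p%:E)%E).

Let class0 : {mfun_ mu, T >-> measurableTypeR R} :=
  \pi_({mfun_ mu, T >-> measurableTypeR R})%qT (cst 0).

Let class0_ae : class0 = cst 0 %[ae mu].
Proof.
by apply/asboolP; rewrite -/(ae_eq_op _ _ _) -eqmodE reprK.
Qed.

Let class0_finite : finite_norm mu p%:E class0.
Proof.
rewrite /finite_norm unlock /Lnorm; apply: poweR_lty.
have -> : (\int[mu]_x `|(EFin \o class0) x| `^ p = \int[mu]_x cst 0 x)%E;
  last by rewrite integral0 ltry.
apply: ae_eq_integral => //.
- have mf : measurable_fun setT (fun x : T => `|(class0 x : R)%:E|%E).
    apply: measurableT_comp => //; apply/measurable_EFinP.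
    exact: (@measurable_funPT _ _ _ _ (repr class0)).
  exact: (measurableT_comp (measurable_poweR p) mf).
- apply: filterS class0_ae => x /(_ Logic.I) x0 _ /=.
  by rewrite x0 /= normr0 powR0// gt_eqF// (lt_le_trans ltr01).
Qed.

HB.instance Definition _ :=
  isFinLebesgue.Build d T R mu p%:E p1 class0 class0_finite.

(* the zero vector of L^p, i.e. the class of the functions that vanish a.e. *)
Definition Lspace_zero : LspaceType mu p1 := class0.

End Lspace_zero.

Lemma lt1_le1e (R : realType) (p : R) : 1 < p -> (1 <= p%:E)%E.
Proof. by move=> p1; rewrite lee_fin ltW. Qed.

(* Elements of L^p are classes modulo a.e. equality; [u x] is the value at x of a
   representative of u, and the integral does not depend on its choice. *)
Definition W_space (R : realType) (d : nat) (p : R) (p1 : (1 <= p%:E)%E)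
    (nu : Rd R d -> R) : set (LspaceType (lebesgue_Rd R d) p1) :=
  [set u : LspaceType (lebesgue_Rd R d) p1 |
    \int[lebesgue_Rd R d]_x \int[lebesgue_Rd R d]_y
      (`|u x - u y| `^ p * nu (Rd_sub x y))%:E < +oo]%E.
Arguments W_space {R d p} p1 nu.

(* Main.v *)
Require Import Defs.
From HB Require Import structures.
From mathcomp Require Import all_boot all_order all_algebra.
From mathcomp Require Import all_classical all_reals all_analysis.
From mathcomp Require Import measurable_realfun.
From mathcomp Require Import ring lra.

Import Order.TTheory GRing.Theory Num.Theory.
Import numFieldNormedType.Exports.

Local Open Scope classical_set_scope.
Local Open Scope ring_scope.

(** Write E_u(h) for the p-th power of the L^p norm of u - u(. - h)
    ([shift_energy]). Substituting y = x - h in the inner integral and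
    exchanging the integrals shows that

      int int |u(x) - u(y)|^p nu(x - y) dy dx = int E_u(h) nu(h) dh

    ([integral_gagliardo]). The theorem therefore reduces to comparing E_u with
    the weight w(h) = min(1, |h|^p), pointwise in h.

    If w nu is integrable, take for u the tent max(0, 1 - |x|_1). It is
    Lipschitz, bounded by 1 and supported in a set of finite measure, so that
    E_u <= C w ([shift_energy_tent]), and the tent is a nonzero element of W.

    Conversely let u be any nonzero element of L^p. Two facts bound E_u from
    below by a multiple of w ([shift_energy_ge]). For large h, most of the mass
    of u sits in a ball which the shift by h moves away from itself, so E_u(h)
    is at least some c > 0 ([shift_energy_large]). For all h, convexity of t^p
    and invariance under translations give E_u(2h) <= 2^p E_u(h)
    ([shift_energy_tdbl]). Doubling a small h about log2(M / |h|) times until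
    its length exceeds M, and applying the second fact at each step and the
    first one at the end, yields
    E_u(h) >= c' |h|^p. Hence finiteness of int E_u nu for a single nonzero u
    makes w nu integrable. The zero class always belongs to W, so that W differs
    from {0} exactly when it has a nonzero element.

    The exchange of integrals needs care with measurability: for a Lebesgue
    measurable nu, the function (x, y) |-> nu(x - y) need not be measurable for
    the product of the completed sigma-algebras. All computations are therefore
    done with Borel functions and the uncompleted measure, and u and nu are
    replaced by Borel functions which agree with them almost everywhere
    ([completed_mfun_version], [gagliardo_version]). *)

Set Implicit Arguments.
Unset Strict Implicit.
Unset Printing Implicit Defensive.

(** * Borel versions for the completion of a sigma-finite measure *)

Section completion.
Context {d : measure_display} {T : measurableType d} {R : realType}.
Variable mu : {sigma_finite_measure set T -> \bar R}.
Local Notation cT := (caratheodory_type (mu^*)%mu).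
Let cmu : {measure set cT -> \bar R} := @completed_measure_extension _ _ _ mu.

Lemma measurable_completed (A : set T) :
  measurable A -> measurable (A : set cT).
Proof. by move=> mA; apply: sub_caratheodory; exact: sub_sigma_algebra. Qed.

Lemma measurable_fun_completed {d'} {V : sigmaRingType d'} (f : T -> V) :
  measurable_fun setT f -> measurable_fun setT (f : cT -> V).
Proof.
move=> mf _ B mB; apply: measurable_completed; exact: mf.
Qed.

Lemma completed_measureE (A : set T) : measurable A -> cmu A = mu A.
Proof. exact: measurable_mu_extE. Qed.

(** The outer measure is an infimum over countable measurable covers; the
    intersection of a minimizing sequence of covers attains it. *)
Lemma measurable_hull (E : set cT) :
  exists F : set T, [/\ measurable F, E `<=` F & mu F = cmu E].
Proof.
have [Eoo|Eoo] := eqVneq (cmu E) +oo%E.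
  exists setT; split => //; apply/eqP; rewrite eq_le Eoo leey/= -Eoo.
  by rewrite -completed_measureE//; apply: le_mu_ext.
have Efin : (mu^*)%mu E \is a fin_num.
  rewrite ge0_fin_numE; last exact: mu_ext_ge0.
  by rewrite lt_neqAle Eoo leey.
have /choice[F PF] (n : nat) : exists F : set T, [/\ measurable F, E `<=` F &
    (mu F <= cmu E + n.+1%:R^-1%:E)%E].
  have n0 : 0 < n.+1%:R^-1 :> R by rewrite invr_gt0.
  have [_ [A EA <-] ltA] := lb_ereal_inf_adherent n0 Efin.
  have mA := cover_measurable EA.
  exists (\bigcup_k A k); split.
  - by apply: bigcupT_measurable => k; apply: mA.
  - exact: cover_subset EA.
  - apply: (le_trans _ (ltW ltA)).
    apply: (measure_sigma_subadditive mu mA) => //.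
    by apply: bigcupT_measurable => k; apply: mA.
have mF : measurable (\bigcap_n F n).
  by apply: bigcapT_measurable => n; have [] := PF n.
have EF : E `<=` \bigcap_n F n by apply: sub_bigcap => n _; have [] := PF n.
exists (\bigcap_n F n); split => //.
apply/eqP; rewrite eq_le; apply/andP; split; last first.
  by rewrite -completed_measureE//; exact: le_mu_ext.
apply/lee_addgt0Pr => _/posnumP[e]; near \oo => n.
have [mFn _ Fn] := PF n.
apply: (@le_trans _ _ (mu (F n))).
  by apply: le_measure; rewrite ?inE//; exact: bigcap_inf.
apply: (le_trans Fn); rewrite leeD2l// lee_fin ltW//.
by near: n; exact: near_infty_natSinv_lt.
Unshelve. all: by end_near. Qed.

Lemma completed_negligible (N : set cT) :
  cmu.-negligible N -> mu.-negligible (N : set T).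
Proof.
move=> [A [mA A0 NA]]; have [F [mF AF F0]] := measurable_hull A.
by exists F; split => //; [rewrite F0|exact: subset_trans AF].
Qed.

(** For sets of finite outer measure the hull differs from the set by a null
    set, because the measures can be subtracted; sigma-finiteness reduces the
    general case to this one. *)
Lemma completed_measurable_version (A : set cT) : measurable A ->
  exists B : set T, [/\ measurable B, A `<=` B & mu.-negligible (B `\` A)].
Proof.
move=> mA; have [S ST PS] := sigma_finiteT mu.
have /choice[B PB] (n : nat) : exists B : set T,
    [/\ measurable B, A `&` S n `<=` B & mu.-negligible (B `\` (A `&` S n))].
  have [mS Soo] := PS n.
  have mAS : measurable (A `&` S n : set cT).
    by apply: measurableI => //; exact: measurable_completed.
  have [B [mB AB BE]] := measurable_hull (A `&` S n).
  have ASoo : (cmu (A `&` S n) < +oo)%E.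
    have Soo' : (cmu (S n) < +oo)%E by rewrite completed_measureE.
    by apply: (le_lt_trans _ Soo'); exact: le_mu_ext.
  exists B; split => //; apply: completed_negligible.
  exists (B `\` (A `&` S n)); split => //.
    by apply: measurableD => //; exact: measurable_completed.
  have mB' := measurable_completed mB.
  have BE' : cmu B = cmu (A `&` S n) by rewrite completed_measureE.
  have Boo : (cmu B < +oo)%E by rewrite BE'.
  rewrite [LHS](measureD mB' mAS Boo).
  rewrite (setIidr AB) [X in (X - _)%E](_ : _ = cmu (A `&` S n))//.
  by apply: subee; rewrite ge0_fin_numE.
exists (\bigcup_n B n); split.
- by apply: bigcupT_measurable => n; have [] := PB n.
- move=> x Ax; have : setT x by [].
  rewrite ST => -[n _ Snx]; exists n => //.
  by have [_ + _] := PB n; apply.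
- apply: (@negligibleS _ _ _ _ (\bigcup_n (B n `\` (A `&` S n)))).
    by move=> x [[n _ Bx] nAx]; exists n => //; split => // -[].
  by apply: negligible_bigcup => n; have [] := PB n.
Qed.

(** f is the supremum over rational q of the functions equal to q on {q < f}
    and to -oo elsewhere. Replacing the countably many superlevel sets by
    measurable versions changes this supremum on a null set only. *)
Lemma completed_mfun_version (f : cT -> R) : measurable_fun setT f ->
  exists2 g : T -> R, measurable_fun setT g &
    mu.-negligible [set x : T | f x <> g x].
Proof.
move=> mf.
have mfq (q : rat) : measurable [set x : cT | ratr q < f x].
  have := mf measurableT `]ratr q, +oo[%classic (measurable_itv _).
  rewrite setTI [X in measurable X -> _](_ : _ = [set x : cT | ratr q < f x])//.
  by apply/seteqP; split => x /=; rewrite in_itv/= andbT.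
have /choice[B PB] (n : nat) : exists B : set T,
    [/\ measurable B, [set x | ratr (odflt 0%Q (unpickle n)) < f x] `<=` B &
     mu.-negligible (B `\` [set x | ratr (odflt 0%Q (unpickle n)) < f x])].
  exact: completed_measurable_version.
(* an enumeration of the rationals; codes of no rational are sent to 0 *)
pose q n : R := ratr (odflt 0%Q (unpickle n)).
pose h n (x : T) : \bar R := if x \in B n then (q n)%:E else -oo%E.
pose g (x : T) : \bar R := esups (h ^~ x) 0.
have mg : measurable_fun setT g.
  apply: measurable_fun_esups => n; apply: measurable_fun_ifT => //.
  apply: (measurable_fun_bool true); rewrite setTI.
  rewrite [X in measurable X](_ : _ = B n); first by have [] := PB n.
  by apply/seteqP; split => x /=; [exact: set_mem|exact: mem_set].
exists (fine \o g); first exact: measurableT_comp.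
apply: (@negligibleS _ _ _ _
    (\bigcup_n (B n `\` [set x | q n < f x]))); last first.
  by apply: negligible_bigcup => n; have [] := PB n.
move=> x /= fg; apply: contrapT => nB; apply: fg.
suff -> : g x = (f x)%:E by [].
have hx n : h n x = if q n < f x then (q n)%:E else -oo%E.
  rewrite /h; have [qf|qf] := boolP (q n < f x).
    by rewrite mem_set//; have [_ + _] := PB n; apply.
  rewrite memNset// => Bx; apply: nB; exists n => //; split => //=.
  exact/negP.
rewrite /g /esups /sdrop/=; apply/eqP; rewrite eq_le; apply/andP; split.
  apply: ge_ereal_sup => _ [n _ <-]; rewrite hx; case: ifPn => [/ltW|_].
    by rewrite lee_fin.
  exact: leNye.
apply/lee_addgt0Pr => e e0.
have /rat_in_itvoo[r] : f x - e < f x by rewrite ltrBlDr ltrDl.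
rewrite in_itv/= => /andP[er rf].
have -> : (f x)%:E = ((f x - e)%:E + e%:E)%E by rewrite -EFinD subrK.
rewrite leeD2r//; apply: (@le_trans _ _ (ratr r)%:E); first exact/ltW.
apply: ereal_sup_ubound; exists (pickle r) => //.
by rewrite hx /q pickleK/= rf.
Qed.

Lemma integral_completed (f : T -> \bar R) : measurable_fun setT f ->
  (forall x, 0 <= f x)%E -> (\int[cmu]_x f x = \int[mu]_x f x)%E.
Proof.
move=> mf f0.
have mid : measurable_fun setT (idfun : cT -> T).
  exact: (measurable_fun_completed (@measurable_id _ T setT)).
transitivity (\int[pushforward cmu (idfun : cT -> T)]_x f x)%E.
  by rewrite ge0_integral_pushforward.
apply: eq_measure_integral => A mA _.
exact: completed_measureE.
Qed.

(** Completeness makes f measurable, because it agrees with g outside a null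
    set. This computes iterated integrals of functions that are not jointly
    measurable. *)
Lemma integral_completed_version (f : cT -> \bar R) (g : T -> \bar R) :
  measurable_fun setT g -> (forall x, 0 <= g x)%E ->
  mu.-negligible [set x : T | f x <> g x] ->
  (\int[cmu]_x f x = \int[mu]_x g x)%E.
Proof.
move=> mg g0 [N [mN N0 fgN]]; rewrite -integral_completed//.
have mg' : measurable_fun setT (g : cT -> \bar R).
  exact: measurable_fun_completed.
have gf : ae_eq cmu setT (g : cT -> \bar R) f.
  exists N; split; first exact: measurable_completed.
    by rewrite completed_measureE.
  by move=> x /= gfx; apply: fgN => /= fgx; apply: gfx => _; rewrite fgx.
apply: ae_eq_integral => //; last exact: ae_eq_sym.
have ccmu : measure_is_complete cmu by exact: measure_is_complete_caratheodory.
exact: (ae_measurable_fun ccmu gf).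
Qed.

End completion.

(** * Invariance of the Borel-Lebesgue measure *)

Section borel.
Context {R : realType}.
Local Notation RT := (measurableTypeR R).
Local Notation mu1 := (@lebesgue_measure R).
Local Notation mu n := (@borel_lebesgue R n).

Lemma integral_lebesgue_reflect (c : R) (f : RT -> \bar R) :
  measurable_fun setT f -> (forall x, 0 <= f x)%E ->
  (\int[mu1]_x f (c - x)%R = \int[mu1]_x f x)%E.
Proof.
move=> mf f0; have mc : measurable_fun setT (fun x : RT => c - x : RT).
  exact: measurable_funB.
transitivity (\int[pushforward mu1 (fun x : RT => (c - x)%R : RT)]_x f x)%E.
  by rewrite ge0_integral_pushforward.
apply: eq_measure_integral => A mA _; apply/esym.
apply: lebesgue_measure_unique => // _ [[a b]] _ <-.
transitivity (mu1 `[c - b, c - a[%classic).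
  rewrite !lebesgue_measure_itv/= !lte_fin ltrD2l ltrN2; case: ifPn => // _.
  by rewrite -!EFinB; congr (_%:E); rewrite opprB [RHS]addrC addrA subrK.
congr (mu1 _); apply/funext => x /=.
rewrite !in_itv/= [in RHS]andbC; congr (is_true (_ && _)).
  by rewrite !lerBlDr addrC.
by rewrite !ltrBrDr addrC.
Qed.

(** The subtraction of R^n, typed with the product sigma-algebra instead of its
    completion: measurability has to be stated for the former. *)
Definition tsub n (x y : n.-tuple RT) : n.-tuple RT :=
  [tuple tnth x i - tnth y i | i < n].

Lemma measurable_tsub {d1} {T1 : measurableType d1} n
    (f g : T1 -> n.-tuple RT) :
  measurable_fun setT f -> measurable_fun setT g ->
  measurable_fun setT (fun x => tsub (f x) (g x)).
Proof.
move=> mf mg; apply/measurable_fun_tnthP => i.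
rewrite (_ : _ \o _ = fun x => tnth (f x) i - tnth (g x) i); last first.
  by apply/funext => x /=; rewrite tnth_mktuple.
by apply: measurable_funB; apply: (measurableT_comp (measurable_tnth i)).
Qed.

Lemma integral_borel_lebesgueS n (f : n.+1.-tuple RT -> \bar R) :
  measurable_fun setT f -> (forall x, 0 <= f x)%E ->
  (\int[mu n.+1]_x f x = \int[mu1]_a \int[mu n]_t f (cons_pair (a, t)))%E.
Proof.
move=> mf f0; transitivity (\int[(mu1 \x mu n)]_z f (cons_pair z))%E.
  exact: (ge0_integral_pushforward (measurable_cons_pair (n:=n))
    (mu1 \x mu n)%E measurableT mf).
rewrite fubini_tonelli1//.
by apply: measurableT_comp => //; exact: measurable_cons_pair.
Qed.

Lemma tsub_cons n (a b : RT) (t s : n.-tuple RT) :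
  tsub (cons_pair (a, t)) (cons_pair (b, s)) = cons_pair (a - b, tsub t s).
Proof.
apply: eq_from_tnth => i; rewrite tnth_mktuple.
by case: (unliftP ord0 i) => [j ->|->]; rewrite ?tnthS ?tnth0// tnth_mktuple.
Qed.

(** Tonelli along the first coordinate reduces the statement to one dimension
    less. Reflections are preferred to translations because y |-> x - y is the
    substitution made in the Gagliardo integral; a translation is the composite
    of two reflections. *)
Lemma integral_reflect n (c : n.-tuple RT) (f : n.-tuple RT -> \bar R) :
  measurable_fun setT f -> (forall x, 0 <= f x)%E ->
  (\int[mu n]_x f (tsub c x) = \int[mu n]_x f x)%E.
Proof.
elim: n c f => [|n IHn] c f mf f0.
  by apply: eq_integral => x _; rewrite (tuple0 (tsub c x)) (tuple0 x).
case/tupleP: c => c0 c.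
rewrite !integral_borel_lebesgueS//; last first.
  apply: measurableT_comp => //.
  by apply: measurable_tsub => //; exact: measurable_id.
have mcons a : measurable_fun setT (fun t : n.-tuple RT => cons_pair (a, t)).
  by apply: measurableT_comp; [exact: measurable_cons_pair|].
transitivity (\int[mu1]_a \int[mu n]_t f (cons_pair ((c0 - a)%R, t)))%E.
  apply: eq_integral => a _.
  under eq_integral do rewrite (tsub_cons c0 a c).
  apply: (IHn c (fun t => f (cons_pair ((c0 - a)%R, t)))) => //.
  exact: measurableT_comp.
apply: (integral_lebesgue_reflect c0
  (f:=fun a => \int[mu n]_t f (cons_pair (a, t)))%E) => [|a].
  apply: (measurable_fun_fubini_tonelli_F (fun z => f (cons_pair z))) => //.
  by apply: measurableT_comp => //; exact: measurable_cons_pair.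
exact: integral_ge0.
Qed.

Lemma integral_shift n (h : n.-tuple RT) (f : n.-tuple RT -> \bar R) :
  measurable_fun setT f -> (forall x, 0 <= f x)%E ->
  (\int[mu n]_x f (tsub x h) = \int[mu n]_x f x)%E.
Proof.
move=> mf f0.
have mh : measurable_fun setT (fun x => f (tsub x h)).
  by apply: measurableT_comp => //; apply: measurable_tsub.
rewrite -(integral_reflect [tuple 0 | i < n] mh)//.
rewrite -[RHS](integral_reflect (tsub [tuple 0 | i < n] h) mf)//.
apply: eq_integral => x _; congr f; apply: eq_from_tnth => i.
by rewrite !tnth_mktuple addrAC.
Qed.

End borel.

(** * The l1 norm and its balls *)

Section l1norm.
Context {R : realType}.
Local Notation RT := (measurableTypeR R).
Local Notation mu n := (@borel_lebesgue R n).

(** Equivalent to the Euclidean norm, with a triangle inequality that holds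
    term by term and a recursion on the dimension that suits product
    measures. *)
Definition l1norm n (x : n.-tuple RT) : R := \sum_(i < n) `|tnth x i|.

Lemma l1norm_ge0 n (x : n.-tuple RT) : 0 <= l1norm x.
Proof. exact: sumr_ge0. Qed.

Lemma l1norm_le n (x y z : n.-tuple RT) :
  (forall i, `|tnth x i| <= `|tnth y i| + `|tnth z i|) ->
  l1norm x <= l1norm y + l1norm z.
Proof. by move=> xyz; rewrite /l1norm -big_split/=; exact: ler_sum. Qed.

Lemma measurable_l1norm n : measurable_fun setT (@l1norm n).
Proof.
apply: measurable_sum => i; apply: measurableT_comp => //.
exact: measurable_tnth.
Qed.

Lemma measurable_enorm n :
  measurable_fun setT (fun x : n.-tuple RT => enorm (x : Rd R n)).
Proof.
apply: (@measurableT_comp _ _ _ _ _ _ (@Num.sqrt R)).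
  by apply: continuous_measurable_fun; exact: sqrt_continuous.
apply: measurable_sum => i; apply: measurable_funX.
exact: measurable_tnth.
Qed.

Lemma enorm_le_l1norm n (x : n.-tuple RT) : enorm (x : Rd R n) <= l1norm x.
Proof.
rewrite /enorm -(ger0_norm (l1norm_ge0 x)) -sqrtr_sqr ler_wsqrtr//.
suff /andP[] : (0 <= l1norm x) &&
    (\sum_(i < n) tnth (x : n.-tuple R) i ^+ 2 <= l1norm x ^+ 2) by [].
rewrite /l1norm; apply: (big_ind2 (fun a b => (0 <= b) && (a <= b ^+ 2))).
- by rewrite lexx expr0n lexx.
- move=> a b a' b' /andP[b0 ab] /andP[b'0 ab']; rewrite addr_ge0//=.
  apply: (le_trans (lerD ab ab')); rewrite sqrrD addrAC lerDl.
  by rewrite mulrn_wge0// mulr_ge0.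
- by move=> i _; rewrite normr_ge0 real_normK ?num_real/=.
Qed.

Lemma l1norm_le_enorm n (x : n.-tuple RT) :
  l1norm x <= n%:R * enorm (x : Rd R n).
Proof.
rewrite mulr_natl -[X in _ *+ X]card_ord -sumr_const; apply: ler_sum => i _.
rewrite -sqrtr_sqr ler_wsqrtr// (bigD1 i)//= lerDl sumr_ge0// => j _.
exact: sqr_ge0.
Qed.

Lemma l1norm_cons n (a : RT) (t : n.-tuple RT) :
  l1norm (cons_pair (a, t)) = `|a| + l1norm t.
Proof.
by rewrite /l1norm big_ord_recl tnth0; congr (_ + _); apply: eq_bigr => i _;
  rewrite tnthS.
Qed.

Lemma l1norm_eq0 n (x : n.-tuple RT) : l1norm x = 0 -> x = (Rd_zero : Rd R n).
Proof.
move=> /eqP; rewrite psumr_eq0// => /allP x0; apply: eq_from_tnth => i.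
rewrite tnth_mktuple; apply/eqP; rewrite -normr_eq0.
exact: (implyP (x0 i (mem_index_enum i))).
Qed.

Lemma measurable_l1ball n (r : R) :
  measurable [set x : n.-tuple RT | l1norm x <= r].
Proof.
rewrite -[X in measurable X]setTI.
rewrite (_ : [set x | _] = @l1norm n @^-1` `]-oo, r]); last first.
  by apply/seteqP; split => x /=; rewrite in_itv.
exact: measurable_l1norm.
Qed.

Lemma borel_lebesgueSE n (A : set (n.+1.-tuple RT)) :
  mu n.+1 A = (@lebesgue_measure R \x mu n)%E (@cons_pair R n @^-1` A).
Proof. by []. Qed.

Lemma l1ball_lty n (r : R) : (mu n [set x | (l1norm x <= r)%R] < +oo)%E.
Proof.
elim: n => [|n IHn].
  by rewrite /= diracE; case: (_ \in _); rewrite ltry.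
rewrite borel_lebesgueSE; apply: (@le_lt_trans _ _
    ((@lebesgue_measure R \x mu n)
      (`[(- r)%R, r] `*` [set x | (l1norm x <= r)%R]))%E).
  apply: le_measure; rewrite ?inE.
  - rewrite -[X in measurable X]setTI; apply: measurable_cons_pair => //.
    exact: measurable_l1ball.
  - by apply: measurableX => //; exact: measurable_l1ball.
  - move=> [a t] /=; rewrite l1norm_cons in_itv/= -ler_norml => atr.
    by split; apply: le_trans atr; rewrite ?lerDl ?lerDr ?l1norm_ge0.
rewrite product_measure1E//; last exact: measurable_l1ball.
rewrite lte_mul_pinfty//.
suff : @lebesgue_measure R `[- r, r]%classic \is a fin_num by [].
by rewrite lebesgue_measure_itv/=; case: ifP.
Qed.

(** In dimension n + 1 the ball contains [0, r/2] x (ball of radius r/2 in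
    dimension n). *)
Lemma l1ball_gt0 n (r : R) : 0 < r -> (0 < mu n [set x | (l1norm x <= r)%R])%E.
Proof.
elim: n r => [|n IHn] r r0.
  rewrite /= diracE mem_set//= /l1norm big_ord0; exact: ltW.
rewrite borel_lebesgueSE; apply: (@lt_le_trans _ _ ((@lebesgue_measure R \x mu n)
    (`[0%R, (r / 2)%R] `*` [set x | (l1norm x <= r / 2)%R]))%E); last first.
  apply: le_measure; rewrite ?inE.
  - by apply: measurableX => //; exact: measurable_l1ball.
  - rewrite -[X in measurable X]setTI; apply: measurable_cons_pair => //.
    exact: measurable_l1ball.
  - move=> [a t] /=; rewrite l1norm_cons in_itv/= => -[/andP[a0 ar] tr].
    by rewrite ger0_norm//; lra.
rewrite product_measure1E//; last exact: measurable_l1ball.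
rewrite mule_gt0// ?IHn ?divr_gt0//.
suff : (0 < @lebesgue_measure R `[0%R, (r / 2)%R]%classic)%E by [].
rewrite lebesgue_measure_itv/= lte_fin divr_gt0//.
by rewrite oppr0 adde0 lte_fin divr_gt0.
Qed.

End l1norm.

(** * The energy of a shift *)

Section shift_energy.
Context {R : realType} (n : nat) (p : R).
Hypothesis p1 : 1 <= p.
Local Notation T := (n.-tuple (measurableTypeR R)).
Local Notation mu := (@borel_lebesgue R n).
Implicit Types (u nu : T -> R) (h x y : T).

Let p0 : 0 < p. Proof. exact: lt_le_trans p1. Qed.

Definition shift_energy u h : \bar R :=
  \int[mu]_x (`|u x - u (tsub x h)| `^ p)%:E.

(** The sharp constant 2^(p - 1), given by convexity, matters: it is what
    leaves exactly 2^p in [shift_energy_tdbl], and hence the exponent p of |h|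
    in the final lower bound. *)
Lemma powR_normD_le (a b : R) :
  `|a + b| `^ p <= 2 `^ (p - 1) * (`|a| `^ p + `|b| `^ p).
Proof.
have half : `|a + b| `^ p <= 2^-1 * (2 * `|a|) `^ p + 2^-1 * (2 * `|b|) `^ p.
  apply: (@le_trans _ _ ((2^-1 * (2 * `|a|) + 2^-1 * (2 * `|b|)) `^ p)).
    rewrite !mulrA mulVf// !mul1r ge0_ler_powR ?nnegrE ?addr_ge0// ?(ltW p0)//.
    exact: ler_normD.
  rewrite {2 4}(_ : 2^-1 = 1 - 2^-1); last by rewrite {2}(splitr 1) div1r addrK.
  by apply: (convex_powR p1 (Itv01 _ _)) => //=;
    rewrite ?inE/= ?in_itv/= ?mulr_ge0 ?normr_ge0// ?invr_ge0// invf_le1 ?ler1n.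
apply: (le_trans half).
rewrite !powRM// !mulrA -powR_inv1// -powRD ?pnatr_eq0 ?implybT//.
by rewrite (addrC _ p) -mulrDr.
Qed.

Lemma measurable_norm_powR {d1} {T1 : measurableType d1} (f : T1 -> R) :
  measurable_fun setT f -> measurable_fun setT (fun w => `|f w| `^ p).
Proof.
move=> mf; apply: (@measurableT_comp _ _ _ _ _ _ (@powR R ^~ p)) => //.
exact: measurableT_comp.
Qed.

Lemma measurable_tsub_l h : measurable_fun setT (fun x => tsub x h).
Proof. exact: measurable_tsub. Qed.

Lemma measurable_shift_energy u : measurable_fun setT u ->
  measurable_fun setT (shift_energy u).
Proof.
move=> mu_.
apply: (measurable_fun_fubini_tonelli_G (m1 := mu)
  (fun z : T * T => (`|u z.1 - u (tsub z.1 z.2)| `^ p)%:E)) => [|z].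
  apply/measurable_EFinP/measurable_norm_powR/measurable_funB.
    exact: measurableT_comp.
  by apply: measurableT_comp => //; exact: measurable_tsub.
by rewrite lee_fin powR_ge0.
Qed.

(** Substitute y = x - h, then exchange the integrals. *)
Lemma integral_gagliardo u nu :
  measurable_fun setT u -> measurable_fun setT nu -> (forall h, 0 <= nu h) ->
  (\int[mu]_x \int[mu]_y (`|u x - u y| `^ p * nu (tsub x y))%:E =
   \int[mu]_h (shift_energy u h * (nu h)%:E))%E.
Proof.
move=> mu_ mnu nu0.
pose f (z : T * T) := (`|u z.1 - u (tsub z.1 z.2)| `^ p * nu z.2)%:E.
have mf : measurable_fun setT f.
  apply/measurable_EFinP/measurable_funM; last exact: measurableT_comp.
  apply/measurable_norm_powR/measurable_funB.
    exact: measurableT_comp.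
  by apply: measurableT_comp => //; exact: measurable_tsub.
have f0 z : (0 <= f z)%E by rewrite lee_fin mulr_ge0// powR_ge0.
transitivity (\int[mu]_x \int[mu]_h f (x, h))%E.
  apply: eq_integral => x _.
  rewrite -[LHS](integral_reflect x); last 2 first.
  - apply/measurable_EFinP/measurable_funM.
      by apply/measurable_norm_powR/measurable_funB.
    by apply: measurableT_comp => //; apply: measurable_tsub.
  - by move=> y; rewrite lee_fin mulr_ge0// powR_ge0.
  apply: eq_integral => h _; rewrite /f/=; congr (_ * nu _)%:E.
  by apply: eq_from_tnth => i; rewrite !tnth_mktuple subKr.
rewrite fubini_tonelli//; apply: eq_integral => h _.
rewrite -ge0_integralZr//.
- apply/measurable_EFinP/measurable_norm_powR/measurable_funB => //.
  by apply: measurableT_comp => //; exact: measurable_tsub_l.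
- exact: nu0.
Qed.

Definition tdbl h : T := [tuple tnth h i + tnth h i | i < n].

Lemma l1norm_tdbl h : l1norm (tdbl h) = 2 * l1norm h.
Proof.
rewrite /l1norm mulr_sumr; apply: eq_bigr => i _.
by rewrite tnth_mktuple -mulr2n normrMn mulr_natl.
Qed.

(** Split u(x) - u(x - 2h) at u(x - h); the second half is a translate of the
    first. *)
Lemma shift_energy_tdbl u h : measurable_fun setT u ->
  (shift_energy u (tdbl h) <= (2 `^ p)%:E * shift_energy u h)%E.
Proof.
move=> mu_; pose F x := (`|u x - u (tsub x h)| `^ p)%:E.
have mF : measurable_fun setT F.
  apply/measurable_EFinP/measurable_norm_powR/measurable_funB => //.
  by apply: measurableT_comp => //; exact: measurable_tsub_l.
have F0 x : (0 <= F x)%E by rewrite lee_fin powR_ge0.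
have mFh : measurable_fun setT (fun x => F (tsub x h)).
  by apply: measurableT_comp => //; exact: measurable_tsub_l.
apply: (@le_trans _ _
    (\int[mu]_x ((2 `^ (p - 1))%:E * (F x + F (tsub x h))))%E).
  apply: ge0_le_integral => //.
  - apply/measurable_EFinP/measurable_norm_powR/measurable_funB => //.
    by apply: measurableT_comp => //; exact: measurable_tsub_l.
  - by apply: measurable_funeM; exact: emeasurable_funD.
  - move=> x _; rewrite -EFinD -EFinM lee_fin.
    have -> : u x - u (tsub x (tdbl h)) =
        (u x - u (tsub x h)) + (u (tsub x h) - u (tsub (tsub x h) h)).
      rewrite addrA subrK; congr (_ - u _); apply: eq_from_tnth => i.
      by rewrite !tnth_mktuple opprD addrA.
    exact: powR_normD_le.
rewrite ge0_integralZl//; last first.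
- by move=> x _; rewrite adde_ge0.
- exact: emeasurable_funD.
rewrite ge0_integralD// integral_shift// -/(shift_energy u h).
rewrite -{1 2}[shift_energy u h]mul1e -ge0_muleDl// muleA -EFinD -EFinM.
rewrite -(natrD _ 1 1) mulrC mulr_powRB1//.
Qed.

Lemma l1norm_tsub_gt x h (r : R) :
  l1norm x <= r -> 2 * r < l1norm h -> r < l1norm (tsub x h).
Proof.
move=> xr rh; have : l1norm h <= l1norm x + l1norm (tsub x h).
  apply: l1norm_le => i; rewrite tnth_mktuple.
  rewrite -[X in `|X| <= _](subKr (tnth x i)).
  by apply: (le_trans (ler_normB _ _)).
lra.
Qed.

(** Choose a ball B outside of which |u|^p has integral at most e. If |h|_1
    exceeds the diameter of B, then x - h is outside B for all x in B, so on B
    convexity bounds |u(x)|^p by 2^(p - 1) times the sum of |u(x) - u(x - h)|^p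
    and of the tail at x - h. Integrating leaves a positive lower bound for the
    energy once e is small compared with the integral of |u|^p. *)
Lemma shift_energy_large u : measurable_fun setT u ->
  (0 < \int[mu]_x (`|u x| `^ p)%:E < +oo)%E ->
  exists M c : R, [/\ 0 < M, 0 < c &
    forall h, M < l1norm h -> (c%:E <= shift_energy u h)%E].
Proof.
move=> mu_ /andP[A0 Aoo].
pose K : R := 2 `^ (p - 1).
have K1 : 1 <= K by rewrite /K -[leLHS](powRr0 2) ler_powR ?ler1n// subr_ge0.
have mup : measurable_fun setT (fun x => (`|u x| `^ p)%:E).
  exact/measurable_EFinP/measurable_norm_powR.
have mball (r : R) : measurable_fun setT (fun x : T => l1norm x <= r).
  apply: measurable_fun_ler => //; exact: measurable_l1norm.
pose g (k : nat) x : \bar R :=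
  if l1norm x <= k%:R then (`|u x| `^ p)%:E else 0%E.
pose t (k : nat) x : \bar R :=
  if l1norm x <= k%:R then 0%E else (`|u x| `^ p)%:E.
have mg k : measurable_fun setT (g k) by apply: measurable_fun_ifT.
have mt k : measurable_fun setT (t k) by apply: measurable_fun_ifT.
have g0 k x : (0 <= g k x)%E by rewrite /g; case: ifP.
have t0 k x : (0 <= t k x)%E by rewrite /t; case: ifP.
have gtA k : (\int[mu]_x g k x + \int[mu]_x t k x =
    \int[mu]_x (`|u x| `^ p)%:E)%E.
  rewrite -ge0_integralD//; apply: eq_integral => x _.
  by rewrite /g /t; case: ifP; rewrite ?adde0 ?add0e.
set A := (\int[mu]_x _)%E in A0 Aoo gtA.
have Afin : A \is a fin_num by rewrite ge0_fin_numE// ltW.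
pose a := fine A; have AE : A = a%:E by rewrite /a fineK.
have a0 : 0 < a by rewrite -lte_fin -AE.
(* chosen so that (a - e) / K - e >= a / (2 * K) *)
pose e := a / (4 * K).
have K0 : 0 < K by exact: lt_le_trans K1.
have e0 : 0 < e by rewrite divr_gt0// mulr_gt0.
(* by monotone convergence of the truncations g k to |u|^p *)
have [k gk] : exists k, ((a - e)%:E < \int[mu]_x g k x)%E.
  apply: contrapT => /forallNP gle.
  have ndg x : nondecreasing_seq (g ^~ x).
    move=> i j ij; rewrite /g; case: ifPn => [xi|_]; last by case: ifPn.
    by rewrite (le_trans xi)// ler_nat.
  have lim_gk x : limn (g ^~ x) = (`|u x| `^ p)%:E.
    apply/cvg_lim => //; apply: (cvg_near_cst).
    exists (Num.truncn (l1norm x)).+1 => // j /= xj.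
    rewrite /g ifT// (le_trans (ltW (truncnS_gt _)))// ler_nat.
    exact: xj.
  have : (A <= (a - e)%:E)%E.
    have -> : A = (\int[mu]_x limn (g ^~ x))%E.
      by apply: eq_integral => x _; rewrite lim_gk.
    rewrite monotone_convergence//; apply: lime_le.
      apply: ereal_nondecreasing_is_cvgn => i j ij.
      by apply: ge0_le_integral => // x _; exact: ndg.
    by apply: nearW => k; rewrite leNgt; apply/negP/gle.
  by rewrite AE lee_fin; lra.
have tk : (\int[mu]_x t k x <= e%:E)%E.
  move: gk (gtA k); rewrite AE.
  have : (0 <= \int[mu]_x t k x)%E by exact: integral_ge0.
  case: (\int[mu]_x g k x)%E => [G| |]; case: (\int[mu]_x t k x)%E => [E| |]//=.
  by rewrite !lee_fin lte_fin => E0 aG [] GE; lra.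
exists (2 * k%:R + 1), (a / (2 * K)); split.
- by rewrite ltr_wpDl// mulr_ge0.
- by rewrite divr_gt0// mulr_gt0.
move=> h hM.
have gle : (\int[mu]_x g k x <= K%:E * (shift_energy u h + \int[mu]_x t k x))%E.
  rewrite -[X in (_ + X)%E](integral_shift h)//.
  have mth : measurable_fun setT (fun x => t k (tsub x h)).
    by apply: measurableT_comp => //; exact: measurable_tsub_l.
  have mF : measurable_fun setT (fun x => (`|u x - u (tsub x h)| `^ p)%:E).
    apply/measurable_EFinP/measurable_norm_powR/measurable_funB => //.
    by apply: measurableT_comp => //; exact: measurable_tsub_l.
  rewrite -ge0_integralD// -ge0_integralZl//; last 3 first.
  - exact: emeasurable_funD.
  - by move=> x _; rewrite adde_ge0.
  - by rewrite lee_fin ltW.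
  apply: ge0_le_integral => //.
  - by apply: measurable_funeM; exact: emeasurable_funD.
  - move=> x _; rewrite {1}/g; case: ifPn => xk; last first.
      by rewrite mule_ge0 ?adde_ge0// lee_fin ltW.
    rewrite /t ifF; last first.
      by apply/negbTE; rewrite -ltNge; apply: l1norm_tsub_gt xk _; lra.
    rewrite -EFinD -EFinM lee_fin.
    rewrite -{1}(subrK (u (tsub x h)) (u x)); exact: powR_normD_le.
have : ((a - e)%:E <= K%:E * (shift_energy u h + e%:E))%E.
  apply: (le_trans (ltW gk)); apply: (le_trans gle).
  apply: lee_wpmul2l; first by rewrite lee_fin ltW.
  exact: leeD2l.
have : (0 <= shift_energy u h)%E.
  by apply: integral_ge0 => x _; rewrite lee_fin powR_ge0.
case: (shift_energy u h) => [s| |]//; last by move=> _ _; rewrite leey.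
rewrite -EFinD -EFinM !lee_fin => s0.
have eK : e * K = a / 4 by rewrite /e; field; rewrite gt_eqF.
rewrite ler_pdivrMr ?mulr_gt0//.
have eK' : e <= e * K by rewrite ler_peMr// ltW.
rewrite mulrDr [K * e]mulrC eK; nra.
Qed.

End shift_energy.

(** * Comparing the energy with min(1, |h|^p) *)

Section comparison.
Context {R : realType} (n : nat) (p : R).
Hypothesis p1 : 1 <= p.
Local Notation T := (n.-tuple (measurableTypeR R)).
Local Notation mu := (@borel_lebesgue R n).
Implicit Types (u : T -> R) (h x : T).

Let p0 : 0 < p. Proof. exact: lt_le_trans p1. Qed.

Let one_powR : 1 `^ p = 1 :> R. Proof. by rewrite powR1. Qed.

Definition levy_weight h : R := Num.min 1 (enorm (h : Rd R n) `^ p).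

Lemma min1_powR (a : R) : 0 <= a -> Num.min 1 a `^ p = Num.min 1 (a `^ p).
Proof.
move=> a0; have [a1|a1] := leP a 1.
  rewrite [RHS]min_r// -one_powR ge0_ler_powR ?nnegrE// ltW//.
rewrite powR1 min_l// -[leLHS]one_powR.
by rewrite ge0_ler_powR ?nnegrE ?(ltW p0) ?(ltW a1).
Qed.

Lemma levy_weightE h : levy_weight h = Num.min 1 (enorm (h : Rd R n)) `^ p.
Proof. by rewrite min1_powR// sqrtr_ge0. Qed.

Lemma levy_weight_ge0 h : 0 <= levy_weight h.
Proof. by rewrite le_min ler01 powR_ge0. Qed.

Lemma measurable_levy_weight : measurable_fun setT levy_weight.
Proof.
apply: measurable_minr => //.
apply: (@measurableT_comp _ _ _ _ _ _ (@powR R ^~ p)) => //.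
exact: measurable_enorm.
Qed.

(** By induction on the number k of doublings after which h has l1 norm larger
    than M: each halving of h divides (|h|_1 / 2M)^p by 2^p, and the energy by
    2^p at most. *)
Lemma shift_energy_ge u : measurable_fun setT u ->
  (0 < \int[mu]_x (`|u x| `^ p)%:E < +oo)%E ->
  exists2 c : R, 0 < c &
    forall h, ((c * levy_weight h)%:E <= shift_energy p u h)%E.
Proof.
move=> mu_ u0; have [M [c [M0 c0 large]]] := shift_energy_large p1 mu_ u0.
(* With 2 * M instead of M, doubling some h with |h|_1 <= M still gives a
   quotient at most 1, so that the truncation by 1 is not active. *)
have key k h : M < 2 ^+ k * l1norm h ->
    ((c * Num.min 1 (l1norm h / (2 * M)) `^ p)%:E <= shift_energy p u h)%E.
  have far g : M < l1norm g ->
      ((c * Num.min 1 (l1norm g / (2 * M)) `^ p)%:E <= shift_energy p u g)%E.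
    move=> /large; apply: le_trans; rewrite lee_fin ler_piMr ?(ltW c0)//.
    rewrite -[leRHS]one_powR ge0_ler_powR ?nnegrE ?(ltW p0) ?ge_min ?lexx//.
    by rewrite le_min ler01 divr_ge0 ?l1norm_ge0 ?mulr_ge0 ?(ltW M0).
  elim: k h => [|k IHk] h; first by rewrite expr0 mul1r; exact: far.
  move=> kM; have [/far//|hM] := ltP M (l1norm h).
  have x0 : 0 <= l1norm h / (2 * M).
    by rewrite divr_ge0 ?l1norm_ge0 ?mulr_ge0 ?(ltW M0).
  have := IHk (tdbl h); rewrite l1norm_tdbl mulrA -exprSr => /(_ kM).
  have -> : 2 * l1norm h / (2 * M) = 2 * (l1norm h / (2 * M)) by rewrite mulrA.
  have x1 : 2 * (l1norm h / (2 * M)) <= 1.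
    by rewrite mulrA ler_pdivrMr ?mulr_gt0// mul1r ler_pM2l.
  rewrite (min_r x1) (powRM _ (ler0n _ 2) x0) => IH2.
  have x1' : l1norm h / (2 * M) <= 1 by lra.
  rewrite (min_r x1').
  have := le_trans IH2 (shift_energy_tdbl p1 h mu_).
  by rewrite mulrCA EFinM lee_pmul2l// ?lte_fin ?powR_gt0.
pose m := Num.min 1 (2 * M)^-1.
have m0 : 0 < m by rewrite lt_min ltr01 invr_gt0 mulr_gt0.
exists (c * m `^ p); first by rewrite mulr_gt0// powR_gt0.
move=> h; have [hE|h0] := eqVneq (l1norm h) 0.
  rewrite levy_weightE min_r; last first.
    by rewrite (le_trans (enorm_le_l1norm h))// hE.
  have -> : enorm (h : Rd R n) = 0.
    by apply/eqP; rewrite eq_le sqrtr_ge0 andbT -hE enorm_le_l1norm.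
  rewrite powR0 ?gt_eqF// mulr0.
  by apply: integral_ge0 => x _; rewrite lee_fin powR_ge0.
have {}h0 : 0 < l1norm h by rewrite lt_neqAle eq_sym h0 l1norm_ge0.
have [k kM] : exists k, M < 2 ^+ k * l1norm h.
  exists (Num.bound (M / l1norm h)); rewrite -ltr_pdivrMr//.
  apply: (lt_le_trans (archi_boundP _)); first by rewrite divr_ge0// ltW.
  by rewrite -natrX ler_nat ltnW// ltn_expl.
apply: le_trans (key k h kM); rewrite lee_fin -mulrA ler_pM2l//.
have e0 : 0 <= enorm (h : Rd R n) by exact: sqrtr_ge0.
have en := enorm_le_l1norm h.
rewrite levy_weightE -powRM ?(ltW m0) ?le_min ?ler01//.
have M2 : 0 < (2 * M)^-1 by rewrite invr_gt0 mulr_gt0.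
apply: ge0_ler_powR; rewrite ?nnegrE ?(ltW p0)//.
- by rewrite mulr_ge0 ?(ltW m0)// le_min ler01.
- by rewrite le_min ler01 mulr_ge0// ltW.
rewrite le_min; apply/andP; split.
  by rewrite mulr_ile1 ?(ltW m0) ?le_min ?ler01// ge_min lexx.
rewrite [leRHS]mulrC ler_pM ?(ltW m0) ?le_min ?ler01//.
  by rewrite ge_min lexx orbT.
by rewrite ge_min en orbT.
Qed.

Definition tent x : R := Num.max 0 (1 - l1norm x).

Lemma measurable_tent : measurable_fun setT tent.
Proof.
apply: measurable_maxr => //; apply: measurable_funB => //.
exact: measurable_l1norm.
Qed.

Lemma tent_ge0 x : 0 <= tent x.
Proof. by rewrite le_max lexx. Qed.

Lemma tent_le1 x : tent x <= 1.
Proof. by rewrite ge_max ler01 gerBl l1norm_ge0. Qed.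

Lemma tent_out x : 1 < l1norm x -> tent x = 0.
Proof. by move=> x1; rewrite /tent max_l// subr_le0 ltW. Qed.

Lemma tent_lipschitz x h : `|tent x - tent (tsub x h)| <= Num.min 1 (l1norm h).
Proof.
have xh : l1norm x <= l1norm (tsub x h) + l1norm h.
  apply: l1norm_le => i; rewrite tnth_mktuple.
  by rewrite -{1}(subrK (tnth h i) (tnth x i)) ler_normD.
have hx : l1norm (tsub x h) <= l1norm x + l1norm h.
  by apply: l1norm_le => i; rewrite tnth_mktuple ler_normB.
have h0 := l1norm_ge0 h; have x0 := l1norm_ge0 x.
have xh0 := l1norm_ge0 (tsub x h).
rewrite le_min ler_norml /tent !maxEle.
by case: ifPn => ?; case: ifPn => ?; apply/andP; split; rewrite ?ler_norml;
  lra.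
Qed.

(** The integrand is at most a multiple of w(h), since the tent is Lipschitz and
    bounded by 1, and vanishes unless x or x - h lies in the unit ball. *)
Lemma shift_energy_tent :
  exists2 C : R, 0 <= C &
    forall h, (shift_energy p tent h <= (C * levy_weight h)%:E)%E.
Proof.
pose B : set T := [set x | l1norm x <= 1].
have mB : measurable B by exact: measurable_l1ball.
have Bfin : mu B \is a fin_num by rewrite ge0_fin_numE// l1ball_lty.
have [b BE b0] : exists2 b : R, mu B = b%:E & 0 <= b.
  by exists (fine (mu B)); [rewrite fineK|exact: fine_ge0].
exists (n.+1%:R `^ p * (2 * b)).
  by rewrite mulr_ge0 ?powR_ge0// mulr_ge0.
move=> h; pose w := n.+1%:R `^ p * levy_weight h.
have w0 : 0 <= w by rewrite mulr_ge0 ?powR_ge0// levy_weight_ge0.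
have pointwise x : `|tent x - tent (tsub x h)| `^ p <=
    w * (\1_B x + \1_B (tsub x h)).
  have [xB|xB] := boolP ((x \in B) || (tsub x h \in B)); last first.
    move: xB; rewrite negb_or => /andP[/negP xB /negP xhB].
    rewrite !tent_out ?subrr ?normr0 ?powR0 ?gt_eqF//; last 2 first.
    - by rewrite ltNge; apply/negP => xh1; apply: xhB; rewrite inE.
    - by rewrite ltNge; apply/negP => x1; apply: xB; rewrite inE.
    by rewrite mulr_ge0// addr_ge0.
  apply: (@le_trans _ _ w); last first.
    rewrite ler_peMr// !indicE.
    by case/orP : xB => ->; rewrite ?lerDl ?lerDr.
  rewrite /w levy_weightE -powRM// ?le_min ?ler01 ?sqrtr_ge0//.
  (* n.+1 instead of n: when |h| > 1 the constant has to be at least 1 *)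
  have n1 : 1 <= n.+1%:R :> R by rewrite ler1n.
  have e0 : 0 <= enorm (h : Rd R n) by exact: sqrtr_ge0.
  apply: ge0_ler_powR; rewrite ?nnegrE ?(ltW p0)//.
    by rewrite mulr_ge0// le_min ler01.
  apply: (le_trans (tent_lipschitz x h)).
  have hn : l1norm h <= n.+1%:R * enorm (h : Rd R n).
    by apply: (le_trans (l1norm_le_enorm h)); rewrite ler_wpM2r// ler_nat.
  have [e1|e1] := leP (enorm (h : Rd R n)) 1.
    by rewrite ge_min hn orbT.
  by rewrite mulr1 ge_min n1.
have mBh : measurable_fun setT (fun x => (\1_B (tsub x h) : R)%:E).
  apply/measurable_EFinP; apply: measurableT_comp => //.
  exact: measurable_tsub_l.
have mB1 : measurable_fun setT (fun x => (\1_B x : R)%:E).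
  exact/measurable_EFinP.
apply: (@le_trans _ _
    (\int[mu]_x (w%:E * ((\1_B x)%:E + (\1_B (tsub x h))%:E)))%E).
  apply: ge0_le_integral => //.
  - apply/measurable_EFinP/measurable_norm_powR/measurable_funB => //.
      exact: measurable_tent.
    by apply: measurableT_comp => //;
      [exact: measurable_tent|exact: measurable_tsub_l].
  - by apply: measurable_funeM; exact: emeasurable_funD.
  - by move=> x _; rewrite -EFinD -EFinM lee_fin; exact: pointwise.
rewrite ge0_integralZl//; last 2 first.
- exact: emeasurable_funD.
- by move=> x _; rewrite adde_ge0.
rewrite ge0_integralD// (integral_shift h (f := fun x => (\1_B x)%:E))//.
have -> : (\int[mu]_x (\1_B x)%:E = b%:E)%E by rewrite integral_indic// setIT.
rewrite -EFinD -EFinM lee_fin.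
by rewrite /w; lra.
Qed.

Lemma integral_tent_powR_lty : (\int[mu]_x (`|tent x| `^ p)%:E < +oo)%E.
Proof.
pose B : set T := [set x | l1norm x <= 1].
have mB : measurable B by exact: measurable_l1ball.
apply: (@le_lt_trans _ _ (\int[mu]_x (\1_B x)%:E)%E); last first.
  by rewrite integral_indic// setIT; exact: l1ball_lty.
apply: ge0_le_integral => //.
- apply/measurable_EFinP; apply: measurable_norm_powR.
  exact: measurable_tent.
- exact/measurable_EFinP.
move=> x _; rewrite lee_fin indicE ger0_norm ?tent_ge0//.
have [xB|xB] := boolP (x \in B).
  rewrite -[leRHS]one_powR ge0_ler_powR ?nnegrE ?(ltW p0) ?tent_ge0//.
  exact: tent_le1.
move: xB; rewrite notin_setE /B/= => /negP; rewrite -ltNge => x1.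
by rewrite tent_out// powR0// gt_eqF.
Qed.

Lemma tent_not_negligible : ~ mu.-negligible [set x | tent x <> 0].
Proof.
move=> neg; have half0 : 0 < 2^-1 :> R by rewrite invr_gt0.
have mB : measurable [set x : T | l1norm x <= 2^-1] by exact: measurable_l1ball.
have /(negligibleP _ mB) B0 : mu.-negligible [set x | l1norm x <= 2^-1].
  apply: negligibleS neg => x /= xB; rewrite /tent max_r; last by lra.
  by apply/eqP; rewrite gt_eqF//; lra.
by have := l1ball_gt0 n half0; rewrite B0 ltxx.
Qed.

End comparison.

(** * Elements of L^p *)

Section Lspace_elements.
Context {d : measure_display} {T : measurableType d} {R : realType}.
Variables (mu : {measure set T -> \bar R}) (p : R) (p1 : (1 <= p%:E)%E).

Lemma finite_normP (f : T -> R) :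
  finite_norm mu p%:E f <-> (\int[mu]_x (`|f x| `^ p)%:E < +oo)%E.
Proof.
have p0 : p^-1 != 0.
  by rewrite invr_neq0// gt_eqF// (lt_le_trans ltr01).
rewrite /finite_norm unlock /Lnorm.
have -> : (\int[mu]_x `|(EFin \o f) x| `^ p = \int[mu]_x (`|f x| `^ p)%:E)%E.
  exact: eq_integral.
by split => [|/poweR_lty]; first exact: lty_poweRy.
Qed.

(** An element of L^p is a class of functions together with a proof that its
    norm is finite, and proofs are irrelevant. *)
Lemma LspaceP (u v : LspaceType mu p1) : u = v %[ae mu] -> u = v.
Proof.
have eq_class (a b : {mfun_ mu, T >-> measurableTypeR R}) :
    a = b %[ae mu] -> a = b.
  by move=> /ae_eqP/eqP; rewrite !reprK.
move=> /eq_class.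
case: u v => [u [[Hu]]] [v [[Hv]]] /= uv; subst v.
by rewrite (Prop_irrelevance Hu Hv).
Qed.

Lemma Lspace_of_fun (f : T -> R) : measurable_fun setT f ->
  (\int[mu]_x (`|f x| `^ p)%:E < +oo)%E ->
  exists u : LspaceType mu p1, u = f %[ae mu].
Proof.
move=> mf foo.
pose g : {mfun T >-> measurableTypeR R} :=
  HB.pack f (isMeasurableFun.Build _ _ T (measurableTypeR R) f mf).
pose c : {mfun_ mu, T >-> measurableTypeR R} :=
  \pi_({mfun_ mu, T >-> measurableTypeR R})%qT g.
have cf : c = f %[ae mu].
  by apply/asboolP; rewrite -[asbool _]/(ae_eq_op mu (repr c) g) -eqmodE reprK.
have c_fin : finite_norm mu p%:E c.
  apply/finite_normP; apply: le_lt_trans foo.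
  rewrite le_eqVlt; apply/orP; left; apply/eqP; apply: ae_eq_integral => //.
  - apply/measurable_EFinP; apply: measurable_norm_powR.
    exact: (@measurable_funPT _ _ _ _ (repr c)).
  - by apply/measurable_EFinP; apply: measurable_norm_powR.
  - by apply: filterS cf => x /(_ Logic.I) cfx _; rewrite cfx.
pose u : LspaceType mu p1 :=
  HB.pack c (isFinLebesgue.Build d T R mu p%:E p1 c c_fin).
by exists u.
Qed.

Lemma Lspace_zero_ae : Lspace_zero mu p1 = cst 0 %[ae mu].
Proof. by apply/asboolP; rewrite -/(ae_eq_op _ _ _) -eqmodE reprK. Qed.

End Lspace_elements.

(** * From Lebesgue measurable to Borel data *)

Section borel_versions.
Context {R : realType} (d : nat) (p : R).
Hypothesis p0 : p != 0.
Local Notation T := (d.-tuple (measurableTypeR R)).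
Local Notation mu := (@borel_lebesgue R d).
Local Notation leb := (lebesgue_Rd R d).

(** Needed because nu and its Borel version differ on a null set of values of
    x - y, whereas the inner integral runs over y. *)
Lemma negligible_reflect (x : T) (N : set T) :
  mu.-negligible N -> mu.-negligible [set y | N (tsub x y)].
Proof.
move=> [A [mA A0 NA]].
have mx : measurable_fun setT (fun y => tsub x y) by exact: measurable_tsub.
exists [set y | A (tsub x y)]; split; last by move=> y /NA.
  by rewrite -[X in measurable X]setTI; exact: mx.
have mxA : measurable [set y | A (tsub x y)].
  by rewrite -[X in measurable X]setTI; exact: mx.
have mind : measurable_fun setT (fun y => (\1_A y : R)%:E).
  exact/measurable_EFinP.
transitivity (\int[mu]_y (\1_A (tsub x y))%:E)%E.
  rewrite -[X in mu X]setIT; apply/esym.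
  exact: (integral_indic mu measurableT mxA).
by rewrite (integral_reflect x mind)// integral_indic// setIT.
Qed.

Lemma integral_Rd_version (f : Rd R d -> \bar R) (g : T -> \bar R) :
  measurable_fun setT g -> (forall x, 0 <= g x)%E ->
  mu.-negligible [set x : T | f x <> g x] ->
  (\int[leb]_x f x = \int[mu]_x g x)%E.
Proof. exact: integral_completed_version. Qed.

Lemma mfun_Rd_version (f : Rd R d -> R) : measurable_fun setT f ->
  exists2 g : T -> R, measurable_fun setT g &
    mu.-negligible [set x : T | f x <> g x].
Proof. exact: completed_mfun_version. Qed.

(** nu is first extended by 0 at the origin, which is where its value is
    arbitrary; truncating the Borel version at 0 keeps it nonnegative
    everywhere. *)
Lemma kernel_version (nu : Rd R d -> R) :
  measurable_fun (~` [set Rd_zero]) nu ->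
  (forall h : Rd R d, h <> Rd_zero -> 0 <= nu h) ->
  exists k : T -> R, [/\ measurable_fun setT k, forall h, 0 <= k h &
    mu.-negligible [set h : T | h <> Rd_zero :> Rd R d /\ nu h <> k h]].
Proof.
move=> mnu nu0.
have m0 : measurable (~` [set Rd_zero] : set (Rd R d)).
  apply: measurableC; apply: measurable_completed.
  rewrite (_ : [set _] = [set x : T | l1norm x <= 0]).
    exact: measurable_l1ball.
  apply/seteqP; split => [_ ->|x /= x0].
    by rewrite /= /l1norm big1// => i _; rewrite tnth_mktuple normr0.
  by apply: l1norm_eq0; apply/eqP; rewrite eq_le x0 l1norm_ge0.
have [k mk nuk] := mfun_Rd_version ((measurable_restrictT _ m0).1 mnu).
exists (fun h => Num.max 0 (k h)); split.
- exact: measurable_maxr.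
- by move=> h; rewrite le_max lexx.
apply: negligibleS nuk => h /= [h0 nukh] nukE; apply: nukh.
rewrite -nukE patchE mem_set//= max_r//; exact: nu0.
Qed.

Variables (nu : Rd R d -> R) (k : T -> R).
Hypothesis mk : measurable_fun setT k.
Hypothesis k0 : forall h, 0 <= k h.
Hypothesis nuk :
  mu.-negligible [set h : T | h <> Rd_zero :> Rd R d /\ nu h <> k h].

(** The value of nu at the origin is multiplied by 0. *)
Lemma levy_integral_version :
  (\int[leb]_h (Num.min 1 (enorm h `^ p) * nu h)%:E =
   \int[mu]_h ((levy_weight p h)%:E * (k h)%:E))%E.
Proof.
apply: integral_Rd_version => [|h|].
- apply/measurable_EFinP/measurable_funM => //; exact: measurable_levy_weight.
- by rewrite mule_ge0 ?lee_fin ?levy_weight_ge0 ?k0.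
- apply: negligibleS nuk => h /= nukh; split.
    move=> h0; apply: nukh; rewrite /levy_weight h0.
    have -> : enorm (Rd_zero : Rd R d) = 0.
      by rewrite /enorm big1 ?sqrtr0// => i _; rewrite tnth_mktuple expr0n.
    by rewrite powR0// min_r// !mul0r mul0e.
  by move=> nukE; apply: nukh; rewrite nukE.
Qed.

(** For every x with u(x) = v(x), the two inner integrands agree for almost all
    y: u(y) <> v(y) on a null set, nu(x - y) <> k(x - y) on the reflection of a
    null set, and at y = x both vanish. So the inner integrals agree for almost
    all x. *)
Lemma gagliardo_version (u : Rd R d -> R) (v : T -> R) :
  measurable_fun setT v -> mu.-negligible [set x : T | u x <> v x] ->
  (\int[leb]_x \int[leb]_y (`|u x - u y| `^ p * nu (Rd_sub x y))%:E =
   \int[mu]_h (shift_energy p v h * (k h)%:E))%E.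
Proof.
move=> mv uv; rewrite -integral_gagliardo//.
have mF : measurable_fun setT
    (fun z : T * T => (`|v z.1 - v z.2| `^ p * k (tsub z.1 z.2))%:E).
  apply/measurable_EFinP/measurable_funM.
    by apply/measurable_norm_powR/measurable_funB; exact: measurableT_comp.
  by apply: measurableT_comp => //; exact: measurable_tsub.
have F0 (z : T * T) : (0 <= (`|v z.1 - v z.2| `^ p * k (tsub z.1 z.2))%:E)%E.
  by rewrite lee_fin mulr_ge0 ?powR_ge0 ?k0.
apply: integral_Rd_version => [|x|].
- exact: (measurable_fun_fubini_tonelli_F (m2 := mu) _ mF F0).
- by apply: integral_ge0 => y _; exact: (F0 (x, y)).
apply: negligibleS (uv) => x /= + uvx; apply.
apply: integral_Rd_version => [|y|].
- exact: (measurableT_comp mF (pair1_measurable x)).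
- exact: (F0 (x, y)).
have := negligibleU uv (negligible_reflect x nuk).
apply: negligibleS => y /= xy; apply: contrapT => /not_orP[/contrapT uvy].
rewrite -implypN => nukxy; apply: xy; rewrite uvx uvy.
have [xy0|xy0] := pselect (tsub x y = Rd_zero :> Rd R d); last first.
  by congr (_ * _)%:E; apply: contrapT => /(nukxy xy0).
have -> : y = x.
  apply: eq_from_tnth => i.
  have := congr1 (fun t : d.-tuple R => tnth t i) xy0.
  by rewrite !tnth_mktuple => /eqP; rewrite subr_eq0 => /eqP.
by rewrite subrr normr0 powR0// !mul0r.
Qed.

End borel_versions.

(** * Nonzero elements of W *)

Section W_space_criterion.
Context {R : realType} (d : nat) (p : R).
Hypothesis p_gt1 : 1 < p.
Local Notation T := (d.-tuple (measurableTypeR R)).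
Local Notation mu := (@borel_lebesgue R d).
Local Notation leb := (lebesgue_Rd R d).
Local Notation Lp := (LspaceType leb (lt1_le1e p_gt1)).
Local Notation zero := (Lspace_zero leb (lt1_le1e p_gt1)).
Variables (nu : Rd R d -> R) (k : T -> R).
Hypothesis mk : measurable_fun setT k.
Hypothesis k0 : forall h, 0 <= k h.
Hypothesis nuk :
  mu.-negligible [set h : T | h <> Rd_zero :> Rd R d /\ nu h <> k h].
Local Notation W := (W_space (lt1_le1e p_gt1) nu).

Let p1 : 1 <= p. Proof. exact: ltW. Qed.
Let p_neq0 : p != 0. Proof. by rewrite gt_eqF// (lt_trans ltr01). Qed.

Let measurable_levy :
  measurable_fun setT (fun h => ((levy_weight p h)%:E * (k h)%:E)%E).
Proof.
by apply/measurable_EFinP/measurable_funM => //; exact: measurable_levy_weight.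
Qed.

Let measurable_energy v : measurable_fun setT v ->
  measurable_fun setT (fun h => (shift_energy p v h * (k h)%:E)%E).
Proof.
move=> mv; apply: emeasurable_funM; last exact/measurable_EFinP.
exact: measurable_shift_energy.
Qed.

Let energy_ge0 (v : T -> R) h : (0 <= shift_energy p v h * (k h)%:E)%E.
Proof.
rewrite mule_ge0 ?lee_fin ?k0//.
by apply: integral_ge0 => x _; rewrite lee_fin powR_ge0.
Qed.

Let levy_ge0 h : (0 <= (levy_weight p h)%:E * (k h)%:E)%E.
Proof. by rewrite mule_ge0 ?lee_fin ?levy_weight_ge0 ?k0. Qed.

Lemma negligible_neq (u v : T -> R) :
  (u : Rd R d -> R) = v %[ae leb] -> mu.-negligible [set x | u x <> v x].
Proof.
move=> uv; apply: completed_negligible; apply: negligibleS uv.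
by move=> x /= ux /(_ Logic.I).
Qed.

Lemma W_spaceP (u : Lp) (v : T -> R) : measurable_fun setT v ->
  mu.-negligible [set x : T | u x <> v x] ->
  W u <-> (\int[mu]_h (shift_energy p v h * (k h)%:E) < +oo)%E.
Proof.
by move=> mv uv; rewrite -(gagliardo_version p_neq0 mk k0 nuk mv uv).
Qed.

(** This rules out that W differs from {0} by being empty. *)
Lemma zero_in_W_space : W zero.
Proof.
apply/(W_spaceP (v := cst 0)) => //.
  exact: (negligible_neq (Lspace_zero_ae _ _)).
rewrite (eq_integral (cst 0%E)) ?integral0// => h _.
rewrite /shift_energy (eq_integral (cst 0%E)) ?integral0 ?mul0e// => x _.
by rewrite subrr normr0 powR0.
Qed.

Lemma W_space_nonzero :
  (\int[mu]_h ((levy_weight p h)%:E * (k h)%:E) < +oo)%E ->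
  exists2 u : Lp, W u & u <> zero.
Proof.
move=> fin; have [C C0 leC] := shift_energy_tent d p1.
have mtent := measurable_tent (R := R) (n := d).
have tent_oo : (\int[leb]_x (`|tent (x : T)| `^ p)%:E < +oo)%E.
  rewrite (integral_Rd_version (g := fun x => (`|tent x| `^ p)%:E)).
  - exact: integral_tent_powR_lty.
  - by apply/measurable_EFinP; apply: measurable_norm_powR.
  - by move=> x; rewrite lee_fin powR_ge0.
  - rewrite (_ : [set _ | _] = set0); first exact: negligible_set0.
    by apply/seteqP; split.
have [u /negligible_neq ut] :=
  Lspace_of_fun (lt1_le1e p_gt1) (measurable_fun_completed mtent) tent_oo.
exists u.
  apply/(W_spaceP mtent ut).
  apply: (@le_lt_trans _ _
      (\int[mu]_h (C%:E * ((levy_weight p h)%:E * (k h)%:E)))%E).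
    apply: ge0_le_integral => //.
    - exact: measurable_energy.
    - exact: measurable_funeM.
    - move=> h _; rewrite muleA; apply: lee_wpmul2r; first exact: k0.
      exact: leC.
  by rewrite ge0_integralZl ?lee_fin// lte_mul_pinfty ?lee_fin.
move=> u0; apply: (tent_not_negligible (R := R) (n := d)).
have := negligible_neq (Lspace_zero_ae leb (lt1_le1e p_gt1)).
rewrite -u0 => u_ae0.
apply: negligibleS (negligibleU ut u_ae0) => x /= tx.
by have [->|] := pselect (u x = tent x); [right|left].
Qed.

Lemma levy_integrable (u : Lp) : W u -> u <> zero ->
  (\int[mu]_h ((levy_weight p h)%:E * (k h)%:E) < +oo)%E.
Proof.
move=> Wu u0; have mu_ : measurable_fun setT (u : Rd R d -> R).
  exact: (@measurable_funPT _ _ _ _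
    (repr (u : {mfun_ leb, Rd R d >-> measurableTypeR R}))).
have [v mv uv] := mfun_Rd_version mu_.
have normE : (\int[leb]_x (`|u x| `^ p)%:E = \int[mu]_x (`|v x| `^ p)%:E)%E.
  apply: integral_Rd_version.
  - by apply/measurable_EFinP; apply: measurable_norm_powR.
  - by move=> x; rewrite lee_fin powR_ge0.
  - by apply: negligibleS (uv) => x /= + uvx; apply; rewrite uvx.
have v_gt0_lty : (0 < \int[mu]_x (`|v x| `^ p)%:E < +oo)%E.
  apply/andP; split; last first.
    by rewrite -normE; apply/(finite_normP _ (lt1_le1e p_gt1));
      exact: Lebesgue_finite.
  rewrite lt_neqAle integral_ge0 ?andbT; last first.
    by move=> x _; rewrite lee_fin powR_ge0.
  apply/eqP => int0; apply: u0; apply: LspaceP.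
  have mup : measurable_fun setT (fun x => (`|u x| `^ p)%:E).
    by apply/measurable_EFinP; apply: measurable_norm_powR.
  have : (\int[leb]_x `|(`|u x| `^ p)%:E| = 0)%E.
    rewrite int0 -normE; apply: eq_integral => x _.
    by rewrite gee0_abs// lee_fin powR_ge0.
  move=> /(ae_eq_integral_abs _ measurableT mup) up0.
  have := Lspace_zero_ae leb (lt1_le1e p_gt1).
  apply: filterS2 up0 => x /(_ Logic.I) + z0 _; rewrite (z0 Logic.I) => -[].
  by move=> /powR_eq0_eq0/eqP; rewrite normr_eq0 => /eqP.
have [c c0 cle] := shift_energy_ge p1 mv v_gt0_lty.
have : (c%:E * \int[mu]_h ((levy_weight p h)%:E * (k h)%:E) < +oo)%E.
  apply: le_lt_trans ((W_spaceP mv uv).1 Wu).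
  rewrite -ge0_integralZl ?lee_fin ?(ltW c0)//.
  apply: ge0_le_integral => //.
  - by move=> h _; apply: mule_ge0; [rewrite lee_fin ltW|exact: levy_ge0].
  - exact: measurable_funeM.
  - exact: measurable_energy.
  - move=> h _; rewrite muleA; apply: lee_wpmul2r; first exact: k0.
    exact: cle.
by case: (\int[_]_h _)%E => [r| |]; rewrite ?ltry ?ltNyr ?gt0_muley ?lte_fin.
Qed.

End W_space_criterion.

Unset Implicit Arguments.
Set Strict Implicit.
Set Printing Implicit Defensive.

Theorem theorem4p3 (R : realType) (d : nat) (hd : (0 < d)%N)
    (p : R) (hp : 1 < p) (nu : Rd R d -> R)
    (nu_meas : measurable_fun (~` [set Rd_zero]) nu)
    (nu_ge0 : forall h : Rd R d, h <> Rd_zero -> 0 <= nu h)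
    (nu_radial : radial nu) :
  (\int[lebesgue_Rd R d]_h (Num.min 1 (enorm h `^ p) * nu h)%:E < +oo)%E <->
  W_space (lt1_le1e hp) nu <>
    [set Lspace_zero (lebesgue_Rd R d) (lt1_le1e hp)].
Proof.
have p_neq0 : p != 0 by rewrite gt_eqF// (lt_trans ltr01).
have [k [mk k0 nuk]] := kernel_version nu_meas nu_ge0.
rewrite (levy_integral_version p_neq0 mk k0 nuk).
split=> [fin W0|W_neq0].
  have [u Wu u0] := W_space_nonzero hp mk k0 nuk fin.
  by apply: u0; move: Wu; rewrite W0.
have [u Wu u0] : exists2 u, W_space (lt1_le1e hp) nu u &
    u <> Lspace_zero (lebesgue_Rd R d) (lt1_le1e hp).
  apply: contrapT => Wzero; apply: W_neq0; apply/seteqP; split => [u Wu|_ ->].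
    by apply: contrapT => u0; apply: Wzero; exists u.
  exact: zero_in_W_space mk k0 nuk.
exact: (levy_integrable mk k0 nuk Wu u0).
Qed.
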